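(* Let $n$, $k$ and $\delta$ be positive integers, and let $\mathbb{G}_k(n,\delta)$ be the class of all $k$-connected graphs of order $n$ with minimum degree at least $\delta$. Among all graphs in $\mathbb{G}_k(n,\delta)$, the graph $$M_{n,\delta}=K_k\vee(K_{\delta-k+1}\cup K_{n-\delta-1})$$ is the unique graph with maximum connective eccentricity index.
   Context: All graphs considered are simple and connected (building blocks in a construction may be combined by disjoint union). For a graph $G$ and $v\in V(G)$, $d_G(v)$ is the degree of $v$ and $\varepsilon_G(v)$ is the eccentricity of $v$, i.e. the maximum distance from $v$ to all other vertices of $G$. The connective eccentricity index (CEI) of $G$ is $\xi^{ce}(G)=\sum_{v\in V(G)}\frac{d_G(v)}{\varepsilon_G(v)}$. The connectivity of $G$ is the minimum size of a set $A\subseteq V(G)$ such that $G-A$ is disconnected or has exactly one vertex. A graph is $k$-connected if its connectivity is at least $k$. The minimum degree of $G$ is the smallest degree of a vertex of $G$. $K_m$ is the complete graph on $m$ vertices ($K_0$ being the graph with no vertices), $\cup$ denotes disjoint union, and the join $M_1\vee M_2$ of disjoint graphs $M_1,M_2$ is obtained from $M_1\cup M_2$ by adding all edges $xy$ with $x\in V(M_1)$, $y\in V(M_2)$.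
   Formalization: The class is taken with connectivity exactly k (with ''at least k'', the complete graph K_n lies in it and has the largest index, so the claim fails); also assumed are k ≤ δ and that the class is non-empty, so that M_{n,δ} is defined and belongs to it. *)

(* Defs.v *)
From HB Require Import structures.
From mathcomp Require Import all_boot all_order all_algebra.

Set Implicit Arguments.
Unset Strict Implicit.
Unset Printing Implicit Defensive.

Import Order.TTheory GRing.Theory Num.Theory.

Record sgraph := SGraph {
  vertex :> finType;
  adj : rel vertex;
  adj_sym : symmetric adj;
  adj_irrefl : irreflexive adj
}.

Definition isomorphic (G H : sgraph) : Prop :=
  exists2 f : G -> H, bijective f & forall x y, adj (f x) (f y) = adj x y.

Section Constructions.

Definition complete_adj m : rel 'I_m := fun x y => x != y.
Fact complete_sym m : symmetric (@complete_adj m).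
Proof. by move=> x y; rewrite /complete_adj eq_sym. Qed.
Fact complete_irrefl m : irreflexive (@complete_adj m).
Proof. by move=> x; rewrite /complete_adj eqxx. Qed.
Definition complete (m : nat) : sgraph :=
  SGraph (@complete_sym m) (@complete_irrefl m).

Variables G H : sgraph.

Definition sum_adj (cross : bool) : rel (G + H)%type := fun u v =>
  match u, v with
  | inl x, inl y => adj x y
  | inr x, inr y => adj x y
  | _, _ => cross
  end.
Fact sum_sym cross : symmetric (sum_adj cross).
Proof. by move=> [x|x] [y|y] //=; apply: adj_sym. Qed.
Fact sum_irrefl cross : irreflexive (sum_adj cross).
Proof. by move=> [x|x] /=; apply: adj_irrefl. Qed.
Definition gunion : sgraph := SGraph (sum_sym false) (sum_irrefl false).
Definition gjoin : sgraph := SGraph (sum_sym true) (sum_irrefl true).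

End Constructions.

Section Deletion.

Variables (G : sgraph) (A : {set G}).

Definition del_adj : rel {x : G | x \notin A} := fun u v => adj (val u) (val v).
Fact del_sym : symmetric del_adj.
Proof. by move=> u v; apply: adj_sym. Qed.
Fact del_irrefl : irreflexive del_adj.
Proof. by move=> u; apply: adj_irrefl. Qed.
Definition gdel : sgraph := SGraph del_sym del_irrefl.

End Deletion.

Definition connected (G : sgraph) : bool :=
  [forall x : G, forall y : G, connect (@adj G) x y].

Section Invariants.

Variable G : sgraph.

Definition deg (v : G) : nat := #|[set u | adj v u]|.

(* The default #|G| exceeds every degree when G is nonempty. *)
Definition min_degree : nat := \big[minn/#|G|]_(v : G) deg v.

(* Least length of a walk from u to v. Shortest walks have length < #|G|;
   the value is #|G| when v is not reachable from u. *)
Definition dist (u v : G) : nat :=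
  find (fun m => [exists p : m.-tuple G, path (@adj G) u p && (last u p == v)])
       (iota 0 #|G|).

Definition ecc (v : G) : nat := \max_(u : G) dist v u.

Definition cei : rat := (\sum_(v : G) (deg v)%:R / (ecc v)%:R)%R.

Definition separating (A : {set G}) : bool :=
  ~~ connected (gdel A) || (#|gdel A| == 1).

(* When G is nonempty, deleting all vertices but one is separating, so the
   default #|G| is never attained. *)
Definition connectivity : nat := \big[minn/#|G|]_(A : {set G} | separating A) #|A|.

End Invariants.

(* The subscript k prescribes the connectivity exactly. If connectivity merely
   at least k were required, the complete graph of order n would belong to the
   class and would always have the largest index. *)
Definition conn_class (n k delta : nat) (G : sgraph) : Prop :=
  [/\ connected G, #|G| = n, connectivity G = k & delta <= min_degree G].

(* delta.+1 - k is delta - k + 1, written so that truncation is harmless. *)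
Definition M_graph (n k delta : nat) : sgraph :=
  gjoin (complete k) (gunion (complete (delta.+1 - k)) (complete (n - delta.+1))).

Definition unique_max_cei (C : sgraph -> Prop) (M : sgraph) : Prop :=
  C M /\ forall G, C G -> ~ isomorphic G M -> (cei G < cei M)%R.

(* Main.v *)
(** Let A be a minimum separating set of G, and let a <= b be the sizes of the
    two sides into which it cuts G. Vertices of A have degree at most n - 1 and
    eccentricity at least 1; the others have eccentricity at least 2 and degree
    at most k + a - 1, resp. k + b - 1. Hence the index of G is at most that of
    K_k \/ (K_a u K_b), with equality only for this graph. This bound is convex in
    a when a + b is fixed, and a >= delta - k + 1 because of the minimum degree,
    so it is largest exactly when a = delta - k + 1. If instead G - A is a single
    vertex, then delta = k = n - 1 and G is complete, as is the extremal graph. *)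
Require Import Defs.
From mathcomp Require Import all_boot all_order all_algebra.
From mathcomp Require Import zify ring.

Set Implicit Arguments.
Unset Strict Implicit.
Unset Printing Implicit Defensive.

Import Order.TTheory GRing.Theory Num.Theory.

(** * Minima over finite families *)

Section BigMin.

Variables (I : finType) (P : pred I) (F : I -> nat) (d : nat).

Lemma leq_bigminn m :
  m <= d -> (forall i, P i -> m <= F i) -> m <= \big[minn/d]_(i | P i) F i.
Proof. by move=> md mF; elim/big_ind: _ => // x y mx my; rewrite leq_min mx. Qed.

Lemma bigminn_leq i : P i -> \big[minn/d]_(i | P i) F i <= F i.
Proof.
move=> Pi; have := mem_index_enum i.
elim: (index_enum I) => // j s IH; rewrite inE big_cons => /predU1P [<-|/IH le_s].
  by rewrite Pi geq_minl.
by case: ifP => // _; rewrite (leq_trans (geq_minr _ _)).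
Qed.

Lemma bigminn_attained : \big[minn/d]_(i | P i) F i < d ->
  exists2 i, P i & F i = \big[minn/d]_(i | P i) F i.
Proof.
elim/big_rec: _ => [|i x Pi IH]; first by rewrite ltnn.
rewrite /minn; case: ifP => [_ _|_ /IH //]; by exists i.
Qed.

End BigMin.

(** * Degrees, walks and eccentricities *)

Section Distance.

Variable G : sgraph.
Implicit Types u v : G.

Lemma deg_lt_order v : deg v < #|G|.
Proof.
rewrite /deg -cardsT; apply: proper_card; apply/properP; split; first exact: subsetT.
by exists v; rewrite ?inE ?adj_irrefl.
Qed.

Lemma dist_leq u p : path (@adj G) u p -> dist u (last u p) <= size p.
Proof.
move=> up; rewrite leqNgt; apply/negP => lt_p.
(* [find] never exceeds the length [#|G|] of the list, so [size p] is among the lengths searched. *)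
have lt_pn : size p < #|G|.
  by rewrite (leq_trans lt_p) // (leq_trans (find_size _ _)) ?size_iota.
have := before_find 0 lt_p; rewrite nth_iota // add0n => /negbT/negP; apply.
by apply/existsP; exists (in_tuple p); rewrite /= up eqxx.
Qed.

Lemma dist_path u v : dist u v < #|G| ->
  exists p, [/\ size p = dist u v, path (@adj G) u p & last u p = v].
Proof.
move=> lt_n; have := lt_n; rewrite -{1}(size_iota 0 #|G|) -has_find.
move=> /(nth_find 0); rewrite nth_iota // add0n.
by move=> /existsP [p /andP [up /eqP pv]]; exists p; rewrite size_tuple.
Qed.

Lemma dist_gt0 u v : u != v -> 0 < dist u v.
Proof.
move=> neq_uv; rewrite lt0n; apply/eqP => d0.
have /dist_path [p []] : dist u v < #|G| by rewrite d0; apply/card_gt0P; exists u.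
by rewrite d0 => /size0nil -> _ /eqP; apply/negP.
Qed.

Lemma dist_gt1 u v : u != v -> ~~ adj u v -> 1 < dist u v.
Proof.
move=> neq_uv nadj; rewrite ltn_neqAle dist_gt0 // andbT eq_sym; apply/eqP => d1.
have /dist_path [p []] : dist u v < #|G|.
  by rewrite d1 (leq_trans _ (max_card [set u; v])) // cards2 neq_uv.
rewrite d1; case: p => [|w [|]] //= _ /andP [uw _] wv.
by rewrite -wv uw in nadj.
Qed.

Lemma dist_leq_ecc u v : dist v u <= ecc v.
Proof. exact: leq_bigmax. Qed.

End Distance.

Lemma dominating_connected (G : sgraph) (w : G) :
  (forall u, u != w -> adj u w) -> connected G.
Proof.
move=> dom; have symG : connect_sym (@adj G).
  by apply: sym_connect_sym => x y; rewrite adj_sym.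
have to_w u : connect (@adj G) u w.
  by have [-> //|/dom /connect1] := eqVneq u w.
apply/forallP => x; apply/forallP => y.
by apply: connect_trans (to_w x) _; rewrite symG.
Qed.

(** * Three-coloured vertex sets *)

(* A vertex cut is encoded as a map into [option bool]: [None] marks the vertices
   of the cut, and [Some true], [Some false] its two sides. *)
Definition compatible (o1 o2 : option bool) : bool :=
  [|| o1 == None, o2 == None | o1 == o2].

Lemma compatible_refl o : compatible o o.
Proof. by rewrite /compatible eqxx !orbT. Qed.

Definition fibre (T : finType) (c : T -> option bool) (o : option bool) : nat :=
  #|[set x | c x == o]|.

Lemma fibre_gt0 (T : finType) (c : T -> option bool) x : 0 < fibre c (c x).
Proof. by apply/card_gt0P; exists x; rewrite inE. Qed.

Lemma sum_option_bool (V : nmodType) (F : option bool -> V) :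
  (\sum_o F o = F None + F (Some true) + F (Some false))%R.
Proof.
rewrite (bigD1 None) // (bigD1 (Some true)) // (bigD1 (Some false)) //= big1.
  by rewrite addr0 addrA.
by move=> [[]|].
Qed.

Lemma sum_fibres (T : finType) (c : T -> option bool) (V : nmodType)
    (F : option bool -> V) :
  (\sum_x F (c x) = F None *+ fibre c None + F (Some true) *+ fibre c (Some true)
     + F (Some false) *+ fibre c (Some false))%R.
Proof.
rewrite (partition_big c predT) //= -(sum_option_bool (fun o => F o *+ fibre c o)%R).
apply: eq_bigr => o _; rewrite (eq_bigr (fun=> F o)) => [|x /eqP -> //].
by rewrite sumr_const /fibre cardsE.
Qed.

Lemma card_fibres (T : finType) (c : T -> option bool) :
  #|T| = fibre c None + fibre c (Some true) + fibre c (Some false).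
Proof.
by rewrite -sum1_card; have := sum_fibres c (fun=> 1%N); rewrite !natn.
Qed.

(** Fibres of the same colour are enumerated and matched rank by rank; [x0] only supplies the
    default of [nth]. *)
Lemma fibres_bijection (S T : finType) (c : S -> option bool) (d : T -> option bool)
    (x0 : S) :
  fibre c =1 fibre d -> exists2 f : S -> T, bijective f & forall x, d (f x) = c x.
Proof.
move=> eq_cd.
have idx x : index x (enum [set y | c y == c x]) < size (enum [set y | d y == c x]).
  by rewrite -cardE -/(fibre d _) -eq_cd /fibre cardE index_mem mem_enum inE.
pose t0 : T := tnth (in_tuple _) (Ordinal (idx x0)).
pose f x := nth t0 (enum [set y | d y == c x]) (index x (enum [set y | c y == c x])).
have df x : d (f x) = c x.
  by have := mem_nth t0 (idx x); rewrite mem_enum inE => /eqP.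
exists f => //; apply: inj_card_bij; last by rewrite (card_fibres c) (card_fibres d) !eq_cd.
move=> x y fxy; have cxy : c x = c y by rewrite -!df fxy.
move: fxy; rewrite /f cxy => /eqP; rewrite nth_uniq ?enum_uniq //; last first.
  by rewrite -cxy.
move=> /eqP exy.
have memx : x \in enum [set z | c z == c y] by rewrite mem_enum inE cxy.
have memy : y \in enum [set z | c z == c y] by rewrite mem_enum inE.
by rewrite -(nth_index x memx) exy nth_index.
Qed.

Lemma ler_frac (d d' e e' : nat) : d <= d' -> 0 < e -> e <= e' ->
  (d%:R / e'%:R <= d'%:R / e%:R :> rat)%R.
Proof.
move=> led e0 lee; apply: ler_pM; rewrite ?ler_nat ?invr_ge0 ?ler0n //.
by rewrite lef_pV2 ?ler_nat // qualifE /= ltr0n // (leq_trans e0).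
Qed.

(** * Upper bound on the index of a coloured graph *)

Section Colouring.

Variables (G : sgraph) (c : G -> option bool).
Implicit Types u v : G.

(** With k, a, b the fibre sizes, this is the degree in K_k \/ (K_a u K_b) of a vertex coloured
    [o]. *)
Definition cdeg (o : option bool) : nat :=
  if o is Some b then (fibre c None + fibre c (Some b)).-1 else #|G|.-1.

(** The eccentricity in the same graph, if all three fibres are non-empty. *)
Definition cecc (o : option bool) : nat := if o is Some _ then 2 else 1.

Lemma card_compatible v :
  #|[set u | compatible (c v) (c u)] :\ v| = cdeg (c v).
Proof.
have -> : forall A : {set G}, v \in A -> #|A :\ v| = #|A|.-1.
  by move=> A Av; rewrite (cardsD1 v A) Av.
- rewrite /cdeg; case cv: (c v) => [b|] /=; last first.
    by congr _.-1; rewrite -cardsT; apply: eq_card => u; rewrite !inE.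
  congr _.-1; rewrite /fibre -cardsUI [X in _ + X]eq_card0 ?addn0.
    by apply: eq_card => u; rewrite !inE /compatible /= [Some b == _]eq_sym.
  by move=> u; rewrite !inE; case: (c u).
- by rewrite inE compatible_refl.
Qed.

Definition separates : Prop := forall u v, adj u v -> compatible (c u) (c v).

(** Every edge that the colouring allows is present: [G] is K_k \/ (K_a u K_b). *)
Definition split : Prop :=
  forall u v, adj u v = (u != v) && compatible (c u) (c v).

Hypothesis sep : separates.

Lemma nbhd_sub v : [set u | adj v u] \subset [set u | compatible (c v) (c u)] :\ v.
Proof.
apply/subsetP => u; rewrite !inE => vu; rewrite sep // andbT.
by apply: contraTneq vu => ->; rewrite adj_irrefl.
Qed.

Lemma deg_leq v : deg v <= cdeg (c v).
Proof. by rewrite -card_compatible subset_leq_card ?nbhd_sub. Qed.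

(** The neighbourhood of [v] lies in a set of [cdeg (c v)] elements, so equal sizes force equal
    sets. *)
Lemma deg_max : (forall v, deg v = cdeg (c v)) -> split.
Proof.
move=> max v u; have := subset_leqif_cards (nbhd_sub v).
rewrite card_compatible -max => - [_]; rewrite eqxx => /esym/eqP/setP/(_ u).
by rewrite !inE eq_sym.
Qed.

Hypotheses (true_gt0 : 0 < fibre c (Some true)) (false_gt0 : 0 < fibre c (Some false)).

Lemma exists_incompatible v : c v != None -> exists u, ~~ compatible (c v) (c u).
Proof.
case cv: (c v) => [b|//] _.
have : 0 < fibre c (Some (~~ b)) by case: b {cv}.
by case/card_gt0P => u; rewrite inE => /eqP cu; exists u; rewrite cu; case: b {cv cu}.
Qed.

(** A vertex of one side is neither equal nor adjacent to one of the other side; a cut vertex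
    differs from any vertex of a side. *)
Lemma cecc_leq v : cecc (c v) <= ecc v.
Proof.
case cv: (c v) => [b|] /=.
  have [|u nvu] := @exists_incompatible v; first by rewrite cv.
  apply: leq_trans (dist_leq_ecc u v); apply: dist_gt1.
    by apply: contraNneq nvu => ->; apply: compatible_refl.
  by apply: contra nvu; apply: sep.
case/card_gt0P: true_gt0 => u; rewrite inE => /eqP cu.
apply: leq_trans (dist_leq_ecc u v); apply: dist_gt0.
by apply: contra_eq_neq cv => ->; rewrite cu.
Qed.

(* The index of K_k \/ (K_a u K_b), where k, a and b are the sizes of the fibres
   of [c], provided that they are all positive. *)
Definition cei_bound : rat := (\sum_(v : G) (cdeg (c v))%:R / (cecc (c v))%:R)%R.

Lemma cei_term_leq v :
  ((deg v)%:R / (ecc v)%:R <= (cdeg (c v))%:R / (cecc (c v))%:R :> rat)%R.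
Proof. by apply: ler_frac; rewrite ?deg_leq ?cecc_leq //; case: (c v). Qed.

Lemma cei_leq_bound : (cei G <= cei_bound)%R.
Proof. by apply: ler_sum => v _; apply: cei_term_leq. Qed.

Lemma cei_bound_split : (cei_bound <= cei G)%R -> split.
Proof.
rewrite -subr_le0 -sumrB => le0; apply: deg_max => v.
have tge0 u : (0 <= (cdeg (c u))%:R / (cecc (c u))%:R - (deg u)%:R / (ecc u)%:R :> rat)%R.
  by rewrite subr_ge0 cei_term_leq.
(* A sum of non-negative defects that is at most 0 has only zero terms. *)
have sum0 : (\sum_(u : G)
    ((cdeg (c u))%:R / (cecc (c u))%:R - (deg u)%:R / (ecc u)%:R) = 0 :> rat)%R.
  by apply/eqP; rewrite eq_le le0 sumr_ge0.
have eq0 u : true -> _ := psumr_eq0P (fun u _ => tge0 u) sum0 (i := u).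
have /eqP := eq0 v isT.
rewrite subr_eq0 => /eqP eqv; apply/eqP; rewrite eqn_leq deg_leq -(ler_nat rat).
have cecc0 : (0 < (cecc (c v))%:R :> rat)%R by rewrite ltr0n; case: (c v).
(* After division by [cecc]: cdeg/cecc = deg/ecc <= deg/cecc, because cecc <= ecc. *)
rewrite -(ler_pM2r (x := (cecc (c v))%:R^-1)%R) ?invr_gt0 // eqv.
by apply: ler_frac => //; [case: (c v)|apply: cecc_leq].
Qed.

End Colouring.

(** * Graphs determined by their colouring *)

Section Split.

Variables (G : sgraph) (c : G -> option bool).
Hypothesis splitc : split c.
Implicit Types u v : G.

Lemma split_separates : separates c.
Proof. by move=> u v; rewrite splitc => /andP []. Qed.

Lemma split_deg v : deg v = cdeg c (c v).
Proof.
rewrite -card_compatible; apply: eq_card => u.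
by rewrite !inE splitc eq_sym.
Qed.

Lemma split_min_degree m :
  m <= #|G| -> (forall v, m <= cdeg c (c v)) -> m <= min_degree G.
Proof. by move=> mG mc; apply: leq_bigminn => // v _; rewrite split_deg. Qed.

Lemma None_dominates w : c w = None -> forall u, u != w -> adj u w.
Proof. by move=> cw u neq; rewrite splitc neq cw /compatible /= orbT. Qed.

Lemma split_connected : 0 < fibre c None -> connected G.
Proof.
case/card_gt0P => w; rewrite inE => /eqP cw.
exact: dominating_connected (None_dominates cw).
Qed.

(** A vertex [w] coloured [None] is adjacent to all others, so it is a common neighbour of any two
    non-adjacent vertices. *)
Lemma ecc_leq_cecc v : 0 < fibre c None -> ecc v <= cecc (c v).
Proof.
case/card_gt0P => w; rewrite inE => /eqP cw; apply/bigmax_leqP => u _.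
have [->|neq_uv] := eqVneq u v; first exact: leq_trans (@dist_leq _ v [::] isT) _.
have [vu|nvu] := boolP (adj v u).
  have := @dist_leq _ v [:: u]; rewrite /= vu => /(_ isT) /leq_trans -> //.
  by case: (c v).
case cv: (c v) => [b|]; last first.
  by rewrite adj_sym (None_dominates cv) in nvu.
have neq_vw : v != w by apply: contra_eq_neq cv => ->; rewrite cw.
have neq_uw : u != w.
  by apply: contraNneq nvu => ->; apply: None_dominates.
apply: (@dist_leq _ v [:: w; u]).
by rewrite /= (None_dominates cw) // adj_sym (None_dominates cw).
Qed.

Lemma cei_bound_leq : 0 < fibre c None -> 1 < #|G| -> (cei_bound c <= cei G)%R.
Proof.
move=> k0 n1; apply: ler_sum => v _.
apply: ler_frac; rewrite ?split_deg ?ecc_leq_cecc //.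
(* The eccentricity must be positive, since dividing by 0 gives 0; a second vertex ensures this. *)
have : 0 < #|[set~ v]| by rewrite cardsC1; case: #|G| n1 => [|[]].
case/card_gt0P => u; rewrite !inE => neq_uv.
by apply: leq_trans (dist_leq_ecc u v); apply: dist_gt0; rewrite eq_sym.
Qed.

(** Deleting the [None] fibre separates the sides or leaves one vertex. A separating set that misses
    some [None] vertex leaves a connected graph, hence a single vertex, so it has [#|G|] - 1
    elements. *)
Lemma split_connectivity :
  (0 < fibre c (Some true)) && (0 < fibre c (Some false))
    || (#|G| == (fibre c None).+1) ->
  connectivity G = fibre c None.
Proof.
move=> nondeg; have lt_kG : fibre c None < #|G|.
  by move: nondeg; rewrite (card_fibres c) eqn_leq; lia.
apply/eqP; rewrite eqn_leq; apply/andP; split.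
  apply: bigminn_leq; rewrite /separating card_sig.
  case/orP: nondeg => [/andP [/card_gt0P [x] + /card_gt0P [y]]|/eqP eqG]; last first.
    apply/orP; right; have := cardsC [set v | c v == None].
    rewrite eqG -addn1 => /addnI <-.
    by apply/eqP/eq_card => u; rewrite !inE.
  rewrite !inE => /eqP cx /eqP cy; apply/orP; left; apply/negP.
  have xA : x \notin [set v | c v == None] by rewrite inE cx.
  have yA : y \notin [set v | c v == None] by rewrite inE cy.
  move/forallP/(_ (Sub x xA))/forallP/(_ (Sub y yA)).
  (* Without the cut, no edge leaves the [Some true] side, so [y] is unreachable from [x]. *)
  have clo : closed (@adj (gdel [set v | c v == None])) [pred u | c (val u) == Some true].
    move=> [u uA] [v vA] /split_separates /=; rewrite !inE /= => cuv.
    rewrite !inE in uA vA; move: cuv uA vA.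
    by case: (c u) (c v) => [[]|] [[]|].
  by move/(closed_connect clo); rewrite !inE /= cx cy.
apply: leq_bigminn => [|A sepA]; first exact: ltnW.
have [sNA|] := boolP ([set v | c v == None] \subset A); first exact: subset_leq_card.
case/subsetPn => w; rewrite inE => /eqP cw wA.
case/orP: sepA => [/negP []|].
  apply: (@dominating_connected (gdel A) (Sub w wA)) => u neq.
  by apply: None_dominates.
rewrite card_sig => /eqP c1; have cA : #|~: A| = 1.
  by rewrite -c1; apply: eq_card => u; rewrite !inE.
by move: (cardsC A); rewrite cA addn1 -ltnS => ->.
Qed.

End Split.

(** * Comparison of the bounds for different side sizes *)

Lemma cei_boundE (G : sgraph) (c : G -> option bool) :
  cei_bound c = (((fibre c None * #|G|.-1) * 2
    + fibre c (Some true) * (fibre c None + fibre c (Some true)).-1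
    + fibre c (Some false) * (fibre c None + fibre c (Some false)).-1)%:R / 2)%R.
Proof.
rewrite /cei_bound (sum_fibres c (fun o => (cdeg c o)%:R / (cecc o)%:R)%R) /=.
rewrite -!(mulr_natl (_ / _)%R) !natrD !natrM; by field.
Qed.

(** Write a = s + x and b = s + y. Passing from sides a, b to s, s + x + y raises the bound by a
    multiple of x y, so the assumed inequality gives x y = 0, and x <= y leaves x = 0. *)
Lemma cei_bound_convex (G H : sgraph) (c : G -> option bool) (d : H -> option bool) :
  #|G| = #|H| -> fibre c None = fibre d None -> 0 < fibre d (Some true) ->
  fibre d (Some true) <= fibre c (Some true) <= fibre c (Some false) ->
  (cei_bound d <= cei_bound c)%R -> fibre c =1 fibre d.
Proof.
move=> eqn eqk s0 /andP [sa ab]; rewrite !cei_boundE ler_pM2r // ler_nat.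
rewrite -eqn -eqk; have := card_fibres c; rewrite eqn (card_fibres d) -eqk.
set k := fibre c None; set a := fibre c _; set b := fibre c _.
set s := fibre d _; set t := fibre d _ => sum le_bound.
have eq_as : a = s.
  have [x ax] : exists x, a = s + x by exists (a - s); lia.
  have [y bx] : exists y, b = s + y by exists (b - s); lia.
  (* As s is positive, [m] turns the truncated predecessors into plain sums. *)
  have [m km] : exists m, k + s = m.+1 by exists (k + s).-1; lia.
  have tE : t = s + x + y by lia.
  (* The difference of the two sides of [le_bound] is [2 x y]. *)
  by move: le_bound ab; rewrite ax bx tE !addnA km !addSn /=; nia.
have eq_bt : b = t by lia.
by move=> [[]|].
Qed.

(** * The extremal graph *)

Section MGraph.

Variables n k delta : nat.

Definition M_colour (u : M_graph n k delta) : option bool :=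
  match u with
  | inl _ => None
  | inr (inl _) => Some true
  | inr (inr _) => Some false
  end.

Lemma M_split : split M_colour.
Proof. by move=> [x|[x|x]] [y|[y|y]]; rewrite /= ?andbT. Qed.

Lemma M_fibre o : fibre M_colour o =
  match o with
  | None => k | Some true => delta.+1 - k | Some false => n - delta.+1
  end.
Proof.
rewrite /fibre -sum1dep_card big_mkcond big_sumType big_sumType /=.
by case: o => [[]|] /=; rewrite !sum_nat_const !card_ord !muln0 muln1 ?addn0 ?add0n.
Qed.

End MGraph.

(** * Isomorphisms and vertex cuts through colourings *)

Lemma split_isomorphic (G H : sgraph) (c : G -> option bool) (d : H -> option bool) :
  0 < #|G| -> split c -> split d -> fibre c =1 fibre d -> isomorphic G H.
Proof.
case/card_gt0P => x0 _ splc spld /(fibres_bijection x0) [f bij_f df].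
(* Adjacency depends only on colours and equality, which [f] preserves. *)
exists f => // x y; rewrite splc spld !df.
by rewrite (inj_eq (bij_inj bij_f)).
Qed.

Lemma disconnected_colouring (G : sgraph) (A : {set G}) :
  ~~ connected (gdel A) ->
  exists c : G -> option bool,
    [/\ separates c, fibre c None = #|A|
      & 0 < fibre c (Some true) <= fibre c (Some false)].
Proof.
case/forallPn => x /forallPn [y nxy].
(* The component of [x] forms one side, all other components the other. *)
pose B := [set val u | u : gdel A & connect (@adj (gdel A)) x u].
pose c v := if v \in A then None else Some (v \in B).
have memB (u : gdel A) : (val u \in B) = connect (@adj (gdel A)) x u.
  by rewrite mem_imset ?inE //; apply: val_inj.
have sepc : separates c.
  move=> u v uv; rewrite /c; case: ifPn => // uA; case: ifPn => [|vA].
    by rewrite /compatible orbT.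
  have uv' : @adj (gdel A) (Sub u uA) (Sub v vA) by [].
  rewrite (_ : (u \in B) = (v \in B)) ?compatible_refl //.
  rewrite -[u](SubK (gdel A) uA) -[v](SubK (gdel A) vA) !memB.
  by apply: same_connect_r; [apply: sym_connect_sym => ? ?; apply: adj_sym|apply: connect1].
have cA : fibre c None = #|A|.
  by apply: eq_card => v; rewrite inE /c; case: (v \in A).
have cx : c (val x) = Some true by rewrite /c (negPf (valP x)) memB connect0.
have cy : c (val y) = Some false by rewrite /c (negPf (valP y)) memB (negPf nxy).
have t0 := fibre_gt0 c (val x); have f0 := fibre_gt0 c (val y).
rewrite cx in t0; rewrite cy in f0.
case: (leqP (fibre c (Some true)) (fibre c (Some false))) => [le_tf|/ltnW le_ft].
  by exists c; rewrite t0.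
(* The sides are swapped so that [Some true] marks the smaller one. *)
pose c' v := omap negb (c v).
have fc' o : fibre c' o = fibre c (omap negb o).
  by apply: eq_card => v; rewrite !inE /c'; case: (c v) o => [[]|] [[]|].
exists c'; rewrite !fc' /= f0; split=> // u v /sepc.
by rewrite /c'; case: (c u) (c v) => [[]|] [[]|].
Qed.

Lemma leq_min_degree (G : sgraph) (v : G) : min_degree G <= deg v.
Proof. exact: bigminn_leq. Qed.

Lemma conn_class_colouring (n k delta : nat) (G : sgraph) :
  0 < n -> k <= delta -> conn_class n k delta G ->
  exists c : G -> option bool,
    [/\ separates c, fibre c None = k &
      [/\ delta.+1 - k <= fibre c (Some true), fibre c (Some true) <= fibre c (Some false)
        & 0 < fibre c (Some true)]
      \/ [/\ split c, delta = k, fibre c (Some true) = 1 & fibre c (Some false) = 0]].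
Proof.
move=> n0 kd [_ cardG connG degG].
have [v0 _] : exists v0 : G, v0 \in G by apply/card_gt0P; rewrite cardG.
have degv (v : G) : delta <= deg v by exact: (leq_trans degG (leq_min_degree v)).
have dn : delta < n by rewrite -cardG (leq_ltn_trans (degv v0)) ?deg_lt_order.
(* Since k <= delta < n, the connectivity lies below its default and is attained. *)
have [|A sepA] := @bigminn_attained _ (@separating G) (fun A => #|A|) #|G|.
  by rewrite -/(connectivity G) connG cardG (leq_ltn_trans kd).
rewrite -/(connectivity G) connG => cA.
case/orP: sepA => [/disconnected_colouring [c [sepc cN /andP [t0 tf]]]|].
  exists c; split=> //; first by rewrite cN.
  left; split=> //.
  case/card_gt0P: (t0) => v; rewrite inE => /eqP cv.
  (* With a the size of the smaller side, delta <= deg v <= k + a - 1. *)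
  by have := leq_trans (degv v) (deg_leq sepc v); rewrite cv /= cN cA; lia.
rewrite card_sig => /eqP c1.
pose c v := if v \in A then None else Some true.
have cN : fibre c None = k.
  by rewrite -cA; apply: eq_card => v; rewrite inE /c; case: (v \in A).
have cT : fibre c (Some true) = 1.
  by rewrite -c1; apply: eq_card => v; rewrite !inE /c; case: (v \in A).
have cF : fibre c (Some false) = 0.
  by apply: eq_card0 => v; rewrite !inE /c; case: (v \in A).
have sepc : separates c.
  by move=> u v _; rewrite /c; case: (u \in A); case: (v \in A).
have nk : #|G| = k.+1 by rewrite (card_fibres c) cN cT cF; lia.
exists c; split=> //; right; split=> //; last by lia.
(* Now n = k + 1, so no [cdeg] exceeds k <= delta <= deg v. *)
apply: deg_max => // v; apply/eqP; rewrite eqn_leq deg_leq // (leq_trans _ (degv v)) //.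
by case: (c v) => [[]|] /=; rewrite ?cN ?cT ?cF ?nk; lia.
Qed.

(** * Maximality and uniqueness of the extremal graph *)

Theorem theorem2p3 (n k delta : nat)
    (n_gt0 : 0 < n) (k_gt0 : 0 < k) (delta_gt0 : 0 < delta)
    (k_le_delta : k <= delta)
    (class_inhabited : exists G : sgraph, conn_class n k delta G) :
  unique_max_cei (conn_class n k delta) (M_graph n k delta).
Proof.
have card_class G : conn_class n k delta G -> #|G| = n by case.
have Mf := M_fibre n k delta; have Ms := @M_split n k delta.
(* A member of the class shows that the prescribed sizes add up to n, with both sides non-empty
   unless n = k + 1. *)
have [dn large] : delta < n /\ (delta.+1 - k <= n - delta.+1 \/ n = k.+1 /\ delta = k).
  case: class_inhabited => G GC; have := card_class G GC.
  have [c [sepc cN []]] := conn_class_colouring n_gt0 k_le_delta GC.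
    by case=> s_le le_tf _; rewrite (card_fibres c) cN => *; split; [|left]; lia.
  by case=> _ dk cT cF; rewrite (card_fibres c) cN cT cF => *; split; [|right]; lia.
have cardM : #|M_graph n k delta| = n.
  by rewrite (card_fibres (@M_colour n k delta)) !Mf; lia.
have n1 : 1 < n by lia.
have N0 : 0 < fibre (@M_colour n k delta) None by rewrite Mf.
split.
  split=> //; first exact: split_connected Ms N0.
    rewrite (split_connectivity Ms) !Mf ?cardM //.
    by case: large => [|[]] *; apply/orP; [left; apply/andP; split|right; apply/eqP]; lia.
  apply: (split_min_degree Ms) => [|v]; first by rewrite cardM; lia.
  have := fibre_gt0 (@M_colour n k delta) v.
  by case: (M_colour v) => [[]|]; rewrite /= !Mf ?cardM; lia.
move=> G GC not_iso; rewrite ltNge; apply/negP => le_MG; apply: not_iso.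
have [c [sepc cN str]] := conn_class_colouring n_gt0 k_le_delta GC.
have cardG := card_class G GC.
have [splc eq_f] : split c /\ fibre c =1 fibre (@M_colour n k delta).
  case: str => [[s_le le_tf t0]|[splc dk cT cF]]; last first.
    split=> // o; rewrite Mf; have := card_fibres c; rewrite cN cT cF cardG => nk.
    by case: o => [[]|]; rewrite ?cN ?cT ?cF; lia.
  have f0 := leq_trans t0 le_tf.
  (* Squeeze: the bound of [M_graph] is at most its index, hence at most that of [G], which is at
     most the bound of [c]. *)
  have le_bM : (cei_bound (@M_colour n k delta) <= cei G)%R.
    by apply: le_trans le_MG; apply: cei_bound_leq; rewrite ?cardM.
  have eq_f : fibre c =1 fibre (@M_colour n k delta).
    apply: cei_bound_convex; rewrite ?cardM ?Mf ?s_le ?le_tf //; first by lia.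
    exact: le_trans le_bM (cei_leq_bound sepc t0 f0).
  (* Equal fibre sizes make the two bounds equal, so [G] attains its own bound. *)
  split=> //; apply: (cei_bound_split sepc t0 f0).
  by apply: le_trans le_bM; rewrite !cei_boundE !eq_f cardG cardM.
by apply: split_isomorphic splc Ms eq_f; rewrite cardG.
Qed.
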